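(* Let $M$ be an invariant submanifold, of dimension $m$, of an $(LCS)_n$-manifold $\widetilde{M}$. The mean curvature of $M$ remains invariant under the quarter symmetric metric connection; that is, the mean curvature vector $\overline{H}$ of $M$ with respect to the quarter symmetric metric connection $\overline{\widetilde{\nabla}}$ equals the mean curvature vector $H$ of $M$ with respect to the Levi-Civita connection $\widetilde{\nabla}$.
   Context: An $(LCS)_n$-manifold (Lorentzian concircular structure manifold) is an $n$-dimensional Lorentzian manifold $(\widetilde{M},g)$, signature $(-,+,\dots,+)$, with Levi-Civita connection $\widetilde{\nabla}$, together with a unit timelike vector field $\xi$ (so $g(\xi,\xi)=-1$), the 1-form $\eta(X)=g(X,\xi)$, and a nowhere zero smooth function $\alpha$ such that $\widetilde{\nabla}_X\xi=\alpha\{X+\eta(X)\xi\}$, equivalently $(\widetilde{\nabla}_X\eta)(Y)=\alpha\{g(X,Y)+\eta(X)\eta(Y)\}$, and $X\alpha=\rho\,\eta(X)$ for all $X$, where $\rho=-(\xi\alpha)$. The structure tensor is the $(1,1)$ tensor $\phi X=\frac1\alpha\widetilde{\nabla}_X\xi=X+\eta(X)\xi$. The quarter symmetric metric connection on $\widetilde{M}$ is $\overline{\widetilde{\nabla}}_XY=\widetilde{\nabla}_XY+\eta(Y)\phi X-g(\phi X,Y)\xi$. A submanifold $M$ of dimension $m<n$ with induced metric (also denoted $g$) is invariant if $\xi$ is tangent to $M$ at every point of $M$ and $\phi(TM)\subset TM$. For $X,Y$ tangent to $M$ one decomposes into tangential and normal parts: $\widetilde{\nabla}_XY=\nabla_XY+\sigma(X,Y)$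 and $\overline{\widetilde{\nabla}}_XY=\overline{\nabla}_XY+\overline{\sigma}(X,Y)$. For a local orthonormal frame $\{e_1,\dots,e_m\}$ of $TM$ (the same frame for both connections), $H=\frac1m\sum_{i=1}^m\sigma(e_i,e_i)$ and $\overline{H}=\frac1m\sum_{i=1}^m\overline{\sigma}(e_i,e_i)$. *)

(* Defs.v *)
(* Smooth manifolds modelled on R^n = 'rV[R]_n over MathComp-Analysis.        *)
(* Tangent vectors at p are derivations at p of the algebra of smooth         *)
(* functions; the metric, the connections, submanifolds and the second        *)
(* fundamental form are defined from them.                                    *)
From HB Require Import structures.
From mathcomp Require Import all_boot all_order all_algebra.
From mathcomp Require Import all_classical all_reals all_analysis.
Set Implicit Arguments.
Unset Strict Implicit.
Unset Printing Implicit Defensive.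
Import Order.TTheory GRing.Theory Num.Theory.
Import numFieldNormedType.Exports.
Local Open Scope classical_set_scope.
Local Open Scope ring_scope.

Section Smooth.
Variables (R : realType) (n : nat) (V : normedModType R).

(* Only meant for an open set W, where the partial derivatives make sense. *)
Fixpoint Ck_on (k : nat) (W : set 'rV[R]_n) (F : 'rV[R]_n -> V) : Prop :=
  (forall x, W x -> {for x, continuous F}) /\
  if k is k'.+1 then
    forall j : 'I_n,
      (forall x, W x -> derivable F x (delta_mx 0 j)) /\
      Ck_on k' W (fun x => 'D_(delta_mx 0 j) F x)
  else True.

Definition smooth_on (W : set 'rV[R]_n) (F : 'rV[R]_n -> V) : Prop :=
  forall k, Ck_on k W F.

End Smooth.

(* A homeomorphism between the open sets [dom] and [cod]; the values of       *)
(* [coord] and [param] outside these sets are irrelevant.                     *)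
Record chart (R : realType) (n : nat) (M : topologicalType) := Chart {
  dom : set M;
  cod : set 'rV[R]_n;
  coord : M -> 'rV[R]_n;
  param : 'rV[R]_n -> M;
  open_dom : open dom;
  open_cod : open cod;
  coord_cod : forall p, dom p -> cod (coord p);
  param_dom : forall x, cod x -> dom (param x);
  coordK : forall p, dom p -> param (coord p) = p;
  paramK : forall x, cod x -> coord (param x) = x;
  coord_continuous : forall p, dom p -> {for p, continuous coord};
  param_continuous : forall x, cod x -> {for x, continuous param}
}.

Record manifold (R : realType) (n : nat) := Manifold {
  carrier :> topologicalType;
  atlas : set (chart R n carrier);
  manifold_hausdorff : hausdorff_space carrier;
  manifold_second_countable : @second_countable carrier;
  atlas_cover : forall p : carrier, exists2 c, atlas c & dom c p;
  atlas_compatible : forall c d, atlas c -> atlas d ->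
    smooth_on [set x | cod c x /\ dom d (param c x)]
              (fun x => coord d (param c x))
}.

Section TangentSpaces.
Variables (R : realType) (n : nat) (M : manifold R n).

Definition smooth_fun_on (W : set M) (h : M -> R) : Prop :=
  forall c, atlas c ->
    smooth_on (V := R^o) [set x | cod c x /\ W (param c x)]
              (fun x => h (param c x)).

Definition smooth_fun (h : M -> R) : Prop := smooth_fun_on setT h.

(* Derivations at p of C^oo(M), extended by 0 to the non-smooth functions, so *)
(* that two tangent vectors are equal iff they agree on C^oo(M).              *)
Definition tangent (p : M) : set ((M -> R) -> R) :=
  [set v | [/\ forall h, ~ smooth_fun h -> v h = 0,
               forall (a : R) h k, smooth_fun h -> smooth_fun k ->
                 v (fun q => a * h q + k q) = a * v h + v k &
               forall h k, smooth_fun h -> smooth_fun k ->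
                 v (fun q => h q * k q) = h p * v k + k p * v h]].

Definition field := M -> ((M -> R) -> R).

Definition deriv_along (X : field) (h : M -> R) : M -> R := fun p => X p h.

(* Smooth vector fields on an open set W; values outside W are irrelevant. *)
Definition vfield_on (W : set M) (X : field) : Prop :=
  (forall p, W p -> tangent p (X p)) /\
  (forall h, smooth_fun h -> smooth_fun_on W (deriv_along X h)).

Definition vfield (X : field) : Prop := vfield_on setT X.

Definition addf (X Y : field) : field := fun p => X p + Y p.
Definition scalef (a : M -> R) (X : field) : field := fun p => a p *: X p.
Definition bracket (X Y : field) : field :=
  fun p h => X p (deriv_along Y h) - Y p (deriv_along X h).

Definition metric := forall p : M, ((M -> R) -> R) -> ((M -> R) -> R) -> R.

(* (e_i) is a basis of T_p M with g_p(e_i, e_j) = eps_i delta_ij. *)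
Definition orthonormal_basis (g : metric) (p : M) (k : nat)
    (eps : 'I_k -> R) (e : 'I_k -> ((M -> R) -> R)) : Prop :=
  [/\ forall i, tangent p (e i),
      forall i j, g p (e i) (e j) = if i == j then eps i else 0 &
      forall v, tangent p v -> exists c : 'I_k -> R, v = \sum_i c i *: e i].

Record lorentzian (g : metric) : Prop := Lorentzian {
  metric_linear : forall p (a : R) u v w,
    tangent p u -> tangent p v -> tangent p w ->
    g p (a *: u + v) w = a * g p u w + g p v w;
  metric_sym : forall p u v, tangent p u -> tangent p v -> g p u v = g p v u;
  metric_smooth : forall X Y, vfield X -> vfield Y ->
    smooth_fun (fun p => g p (X p) (Y p));
  metric_signature : forall p, exists e : 'I_n -> ((M -> R) -> R),
    orthonormal_basis g p (fun i => if i == 0%N :> nat then -1 else 1) e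
}.

Definition connection := field -> field -> field.

Record levi_civita (g : metric) (nabla : connection) : Prop := LeviCivita {
  nabla_vfield : forall X Y, vfield X -> vfield Y -> vfield (nabla X Y);
  nabla_addl : forall X Y Z, vfield X -> vfield Y -> vfield Z ->
    nabla (addf X Y) Z = addf (nabla X Z) (nabla Y Z);
  nabla_scalel : forall a X Y, smooth_fun a -> vfield X -> vfield Y ->
    nabla (scalef a X) Y = scalef a (nabla X Y);
  nabla_addr : forall X Y Z, vfield X -> vfield Y -> vfield Z ->
    nabla X (addf Y Z) = addf (nabla X Y) (nabla X Z);
  nabla_leibniz : forall a X Y, smooth_fun a -> vfield X -> vfield Y ->
    nabla X (scalef a Y) =
      addf (scalef (deriv_along X a) Y) (scalef a (nabla X Y));
  nabla_torsion_free : forall X Y, vfield X -> vfield Y ->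
    (fun p => nabla X Y p - nabla Y X p) = bracket X Y;
  nabla_metric : forall X Y Z, vfield X -> vfield Y -> vfield Z ->
    forall p, X p (fun q => g q (Y q) (Z q)) =
      g p (nabla X Y p) (Z p) + g p (Y p) (nabla X Z p)
}.

Section StructureTensors.
Variables (g : metric) (xi : field).

Definition eta (p : M) (v : (M -> R) -> R) : R := g p v (xi p).

Definition phi (p : M) (v : (M -> R) -> R) : (M -> R) -> R :=
  v + eta p v *: xi p.

Definition quarter_symmetric (nabla : connection) : connection :=
  fun X Y p =>
    nabla X Y p + eta p (Y p) *: phi p (X p) - g p (phi p (X p)) (Y p) *: xi p.

End StructureTensors.

Record lcs (g : metric) (nabla : connection) (xi : field) (alpha : M -> R) :
    Prop := LCS {
  lcs_lorentzian : lorentzian g;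
  lcs_levi_civita : levi_civita g nabla;
  lcs_vfield : vfield xi;
  lcs_unit : forall p, g p (xi p) (xi p) = -1;
  lcs_smooth : smooth_fun alpha;
  lcs_neq0 : forall p, alpha p != 0;
  lcs_concircular : forall X, vfield X ->
    nabla X xi = fun p => alpha p *: (X p + eta g xi p (X p) *: xi p);
  lcs_alpha : forall X, vfield X ->
    forall p, X p alpha = - xi p alpha * eta g xi p (X p)
}.

End TangentSpaces.

Section Submanifolds.
Variables (R : realType) (m n : nat) (M : manifold R m) (N : manifold R n).

Definition smooth_map (f : M -> N) : Prop :=
  continuous f /\
  forall c d, atlas c -> atlas d ->
    smooth_on [set x | cod c x /\ dom d (f (param c x))]
              (fun x => coord d (f (param c x))).

(* The differential of f at any point, on tangent vectors. *)
Definition push (f : M -> N) (v : (M -> R) -> R) : (N -> R) -> R :=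
  fun h => if `[< smooth_fun h >] then v (h \o f) else 0.

(* A submanifold of N is a manifold M with an immersion into N; T_p M is      *)
(* identified with [tangent_image f p], a subspace of T_(f p) N.              *)
Definition immersion (f : M -> N) : Prop :=
  smooth_map f /\ forall p v, tangent p v -> push f v = 0 -> v = 0.

Variables (g : metric N) (f : M -> N).

Definition tangent_image (p : M) : set ((N -> R) -> R) :=
  [set push f v | v in tangent p].

Definition normal_space (p : M) : set ((N -> R) -> R) :=
  [set w | tangent (f p) w /\
           forall t, tangent_image p t -> g (f p) w t = 0].

(* The z such that w = t + z with t tangent and z normal to M; it exists and  *)
(* is unique when w is tangent to N and the induced metric on T_p M is        *)
(* nondegenerate, e.g. when N is Lorentzian and T_p M contains a timelike     *)
(* vector.                                                                    *)
Definition normal_part (p : M) (w : (N -> R) -> R) : (N -> R) -> R :=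
  xget 0 [set z | normal_space p z /\ tangent_image p (w - z)].

Definition induced_metric : metric M :=
  fun p u v => g (f p) (push f u) (push f v).

Definition orthonormal_frame (U : set M) (e : 'I_m -> field M) : Prop :=
  (forall i, vfield_on U (e i)) /\
  (forall p, U p -> exists2 eps : 'I_m -> R,
     (forall i, eps i = 1 \/ eps i = -1) &
     orthonormal_basis induced_metric p eps (fun i => e i p)).

(* The ambient field Y extends the field X of M near p. *)
Definition extends_near (p : M) (X : field M) (Y : field N) : Prop :=
  vfield Y /\ \forall q \near p, Y (f q) = push f (X q).

(* The normal part of (nabla_X Y)(p) for fields of M near p, X and Y being    *)
(* ambient fields that extend them near p; only the restrictions of X and Y   *)
(* to M near p matter.                                                        *)
Definition second_fundamental_form (nabla : connection N)
    (X Y : field N) (p : M) : (N -> R) -> R :=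
  normal_part p (nabla X Y (f p)).

Definition mean_curvature (nabla : connection N) (e : 'I_m -> field N)
    (p : M) : (N -> R) -> R :=
  m%:R^-1 *: \sum_i second_fundamental_form nabla (e i) (e i) p.

Definition invariant_submanifold (xi : field N) : Prop :=
  [/\ immersion f,
      forall p, tangent_image p (xi (f p)) &
      forall p t, tangent_image p t -> tangent_image p (phi g xi (f p) t)].

End Submanifolds.

(* Main.v *)
Require Import Defs.
From mathcomp Require Import all_boot all_order all_algebra.
From mathcomp Require Import all_classical all_reals all_analysis.
From mathcomp Require Import ring.
Set Implicit Arguments.
Unset Strict Implicit.
Unset Printing Implicit Defensive.
Import Order.TTheory GRing.Theory Num.Theory.
Import numFieldNormedType.Exports.
Local Open Scope classical_set_scope.
Local Open Scope ring_scope.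

(** At a point, the two connections differ by a linear combination of [phi X] and [xi]. On an
    invariant submanifold both vectors are tangent as soon as [X] is, and the normal part of a
    vector depends only on its class modulo the tangent space ([normal_part_addr_tangent]). Hence
    the two second fundamental forms agree, and the mean curvatures agree term by term. *)

Lemma tangent_linear (R : realType) (n : nat) (M : manifold R n) (p : M)
    (a b : R) (u v : (M -> R) -> R) :
  tangent p u -> tangent p v -> tangent p (a *: u + b *: v).
Proof.
move=> [u0 ul um] [v0 vl vm].
have E h : (a *: u + b *: v) h = a * u h + b * v h by [].
split=> [h hN|c h k hS kS|h k hS kS]; rewrite !E.
- by rewrite u0 // v0 // !mulr0 addr0.
- by rewrite ul // vl //; ring.
- by rewrite um // vm //; ring.
Qed.

Section TangentImage.
Variables (R : realType) (m n : nat) (M : manifold R m) (N : manifold R n).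
Variable f : M -> N.

Lemma push_linear (a b : R) (u v : (M -> R) -> R) :
  push f (a *: u + b *: v) = a *: push f u + b *: push f v.
Proof.
apply/funext => h.
rewrite [RHS](_ : _ = a * push f u h + b * push f v h) // /push.
(* On a non-smooth [h], [push] takes its default value 0, so both sides vanish. *)
by case: asboolP => // _; rewrite !mulr0 addr0.
Qed.

Lemma tangent_image_linear (p : M) (a b : R) (s t : (N -> R) -> R) :
  tangent_image f p s -> tangent_image f p t ->
  tangent_image f p (a *: s + b *: t).
Proof.
move=> [u uT <-] [v vT <-]; exists (a *: u + b *: v); last exact: push_linear.
exact: tangent_linear.
Qed.

(** As the tangent image is a linear subspace, [w + t - z] lies in it exactly when [w - z] does. So
    [xget] chooses from the same set on both sides, whether or not that set is a singleton. *)
Lemma normal_part_addr_tangent (g : metric N) (p : M)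
    (w t : (N -> R) -> R) :
  tangent_image f p t -> normal_part g f p (w + t) = normal_part g f p w.
Proof.
move=> tT; rewrite /normal_part; congr (xget 0 _).
apply/seteqP; split=> z /= [zN wzT]; split=> //.
- have := tangent_image_linear (-1) 1 tT wzT.
  by rewrite scaleN1r scale1r -addrA addrCA addKr.
- have := tangent_image_linear 1 1 tT wzT.
  by rewrite !scale1r addrA [t + w]addrC.
Qed.

(* The difference eta(Y) phi(X) - g(phi X, Y) xi of the two connections is
   tangent to an invariant submanifold, so it does not contribute to the
   normal part. *)
Lemma second_fundamental_form_quarter_symmetric (g : metric N)
    (nabla : connection N) (xi X Y : field N) (p : M) :
  invariant_submanifold g f xi -> tangent_image f p (X (f p)) ->
  second_fundamental_form g f (quarter_symmetric g xi nabla) X Y p =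
  second_fundamental_form g f nabla X Y p.
Proof.
move=> [_ xiT phiT] XT.
rewrite /second_fundamental_form /quarter_symmetric -addrA.
(* The minus sign moves into the coefficient of [xi], so that the correction becomes a linear
   combination. *)
apply: normal_part_addr_tangent; rewrite -scaleNr.
by apply: tangent_image_linear; [exact: phiT | exact: xiT].
Qed.

End TangentImage.

Theorem theorem4p2 (R : realType) (m n : nat) (M : manifold R m)
    (N : manifold R n) (g : metric N) (nabla : connection N) (xi : field N)
    (alpha : N -> R) (f : M -> N) :
  lcs g nabla xi alpha ->
  (m < n)%N ->
  invariant_submanifold g f xi ->
  forall (U : set M) (e : 'I_m -> field M),
    open U -> orthonormal_frame g f U e ->
    forall (p : M) (E : 'I_m -> field N),
      U p -> (forall i, extends_near f p (e i) (E i)) ->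
      mean_curvature g f (quarter_symmetric g xi nabla) E p =
      mean_curvature g f nabla E p.
Proof.
move=> _ _ invM U e _ [eV _] p E Up Ee.
rewrite /mean_curvature; congr (_ *: _); apply: eq_bigr => i _.
apply: second_fundamental_form_quarter_symmetric => //.
(* The extension property, read at [p] itself, shows that [E i (f p)] is the push-forward of the
   frame vector [e i p]. *)
have [_ /nbhs_singleton ->] := Ee i; exists (e i p) => //.
by have [eT _] := eV i; exact: eT.
Qed.
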